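(* Consider a dynamic stochastic block model (DSBM) with $n$ nodes, $L$ time instants and true tensor of connection probabilities $\Lambda^*$, with vectorized version $\theta^*\in\mathbb R^{NL}$, $N=n(n-1)/2$. Let $H\in\mathbb R^{L\times L}$ be an orthogonal matrix and let $0\le n_0\le n$. Let $\hat\Lambda$ be the penalized least squares estimator described in the context with $\mathcal C(m,n,L)=\mathcal Z(m,n,n_0,L)$, the collection of sequences of clustering matrices in which at most $n_0$ nodes change their memberships between any two consecutive time points. Put $$\mathrm{Pen}(|J|,m)=11\left[n\log m+n_0(L-1)\log\Big(\frac{mne}{n_0}\Big)+\frac{|J|}{2}\log\Big(\frac{25\,m^2L}{|J|}\Big)\right],$$ where the second term is $0$ if $n_0=0$. Then, for any $t>0$, with probability at least $1-9e^{-t}$, $$\frac{\|\hat\Lambda-\Lambda^*\|^2}{n^2L}\le\min_{m,J,d,\;C\in\mathcal Z(m,n,n_0,L)}\left[\frac{6\,\|CW^Td_{(J)}-\theta^*\|^2}{n^2L}+\frac{4\,\mathrm{Pen}(|J|,m)}{n^2L}\right]+\frac{38\,t}{n^2L},$$ and $$\mathbb E\left(\frac{\|\hat\Lambda-\Lambda^*\|^2}{n^2L}\right)\le\min_{m,J,d,\;C\in\mathcal Z(m,n,n_0,L)}\left[\frac{6\,\|CW^Td_{(J)}-\theta^*\|^2}{n^2L}+\frac{4\,\mathrm{Pen}(|J|,m)}{n^2L}+\frac{342}{n^2L}\right].$$ Here the minima are over $m\in\{1,\dots,n\}$, nonempty $J\subseteq\{1,\dots,ML\}$ with $M=m(m+1)/2$,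 $d\in\mathbb R^{ML}$ and $C\in\mathcal Z(m,n,n_0,L)$; $W=H\otimes I_M$; and $d_{(J)}$ is $d$ with all elements $d_j$, $j\notin J$, set to zero.
   Context: Observations: $B_{i,j,l}\in\{0,1\}$ for $1\le i,j\le n$, $1\le l\le L$, with $B_{i,j,l}=B_{j,i,l}$, $B_{i,i,l}=0$, and $\{B_{i,j,l}: i<j,\ 1\le l\le L\}$ independent Bernoulli variables with $\mathbb P(B_{i,j,l}=1)=\Lambda^*_{i,j,l}$; $\Lambda^*_{i,i,l}=0$, $\Lambda^*_{i,j,l}=\Lambda^*_{j,i,l}$. Clustering matrices: $\mathcal M(m,n)$ is the set of matrices $Z\in\{0,1\}^{n\times m}$ with exactly one 1 in each row; $Z_{ik}=1$ iff node $i$ belongs to class $\Omega_k$. $\mathcal Z(m,n,n_0,L)\subseteq\prod_{l=1}^L\mathcal M(m,n)$ is the set of sequences $(Z^{(1)},\dots,Z^{(L)})$ such that at most $n_0$ nodes change class between $Z^{(l)}$ and $Z^{(l+1)}$ for each $l=1,\dots,L-1$. DSBM with $m$ classes: at each time $l$ the nodes are grouped into classes by a matrix $Z^{(l)}\in\mathcal M(m,n)$, and $\Lambda_{i,j,l}=G_{k,k',l}$ ($i\ne j$) if $i\in\Omega_k$, $j\in\Omega_{k'}$ at time $l$, where $G\in[0,1]^{m\times m\times L}$, $G_{k,k',l}=G_{k',k,l}$. Vectorization: $N=n(n-1)/2$, $M=m(m+1)/2$. $a^{(l)},\theta^{(l)}\in\mathbb R^N$ are the vectors of entries $B_{i_1,i_2,l}$,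 $\Lambda_{i_1,i_2,l}$ with $i_1<i_2$; $q^{(l)}\in\mathbb R^M$ is the vector of entries $G_{k_1,k_2,l}$ with $k_1\le k_2$. $C^{(l)}\in\{0,1\}^{N\times M}$ has entry 1 in the row of $(i_1,i_2)$ and the column of $(k_1,k_2)$ iff, under $Z^{(l)}$, one of the nodes $i_1,i_2$ is in $\Omega_{k_1}$ and the other is in $\Omega_{k_2}$. $a,\theta\in\mathbb R^{NL}$, $q\in\mathbb R^{ML}$ are obtained by stacking over $l=1,\dots,L$, and $C\in\{0,1\}^{NL\times ML}$ is block diagonal with blocks $C^{(1)},\dots,C^{(L)}$, so that $\theta=Cq$. A sequence $(Z^{(1)},\dots,Z^{(L)})\in\mathcal Z(m,n,n_0,L)$ is identified with its matrix $C$. $\theta^*$ is the vector $\theta$ obtained from $\Lambda^*$. Transform: $W=H\otimes I_M$ and $d=Wq$. Estimator: $(\hat m,\hat J,\hat d,\hat C)$ is any minimizer of $$\|a-CW^Td\|^2+11\log|\mathcal C(m,n,L)|+\tfrac{11}{2}|J|\log\big(25m^2L/|J|\big)$$ over $m\in\{1,\dots,n\}$, nonempty $J\subseteq\{1,\dots,ML\}$, $d\in\mathbb R^{ML}$ with $d_j=0$ for $j\notin J$, and $C\in\mathcal C(m,n,L)$ ($M$, $W$ depend on $m$). With $\hat M=\hat m(\hat m+1)/2$, $\hat W=H\otimes I_{\hat M}$ put $\hat\theta=\hat C\hat W^T\hat d$; $\hat\Lambda$ is the tensor, symmetric in its first two indices with zero diagonals, whose vectorized version is $\hat\theta$. Norms: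 $\|\cdot\|$ is the Euclidean norm for vectors and the square root of the sum of squared entries for tensors. *)

(* Defs.v *)
From HB Require Import structures.
From mathcomp Require Import all_boot all_order all_algebra.
From mathcomp Require Import mxtens.
From mathcomp Require Import all_classical all_reals all_analysis.

Set Implicit Arguments.
Unset Strict Implicit.
Unset Printing Implicit Defensive.
Import Order.TTheory GRing.Theory Num.Theory.
Local Open Scope classical_set_scope.
Local Open Scope ring_scope.

Definition mutually_independent d d' (T : measurableType d)
    (S : measurableType d') (R : realType) (P : probability T R)
    (I : finType) (D : {set I}) (X : I -> T -> S) : Prop :=
  forall (F : {set I}) (A : I -> set S),
    F \subset D -> (forall i, measurable (A i)) ->
    P (\bigcap_(i in [set` F]) (X i @^-1` A i)) =
    (\prod_(i in F) P (X i @^-1` A i))%E.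

Definition tensor (R : Type) (n L : nat) := 'I_n -> 'I_n -> 'I_L -> R.

Definition symmetric_hollow (V : nmodType) n L (T : tensor V n L) : Prop :=
  (forall i j l, T i j l = T j i l) /\ (forall i l, T i i l = 0).

(* The library norm [`|x|] on matrices is the sup norm, hence these. *)
Definition vnorm (R : realType) k (x : 'cV[R]_k) : R :=
  Num.sqrt (\sum_i x i ord0 ^+ 2).

Definition tnorm (R : realType) n L (T : tensor R n L) : R :=
  Num.sqrt (\sum_i \sum_j \sum_l T i j l ^+ 2).

Definition node_pairs n : {set 'I_n * 'I_n} :=
  [set p : 'I_n * 'I_n | (p.1 < p.2)%N]%SET.

Definition class_pairs m : {set 'I_m * 'I_m} :=
  [set k : 'I_m * 'I_m | (k.1 <= k.2)%N]%SET.

Lemma sum_ord_lt n k : (k <= n)%N -> (\sum_(i < n | (i < k)%N) 1)%N = k.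
Proof.
move=> le_kn; rewrite -(big_ord_widen n (fun=> 1%N) le_kn) sum1_card card_ord //.
Qed.

Lemma card_node_pairs n : #|node_pairs n| = (n * n.-1)./2.
Proof.
rewrite -bin2 -bin2_sum -sum1_card.
under eq_bigl do rewrite inE.
rewrite -(pair_big_dep xpredT (fun i j : 'I_n => (i < j)%N) (fun _ _ => 1%N)) /=.
rewrite (exchange_big_dep xpredT) //= big_mkord; apply: eq_bigr => j _.
by rewrite sum_ord_lt // ltnW.
Qed.

Lemma card_class_pairs m : #|class_pairs m| = (m * m.+1)./2.
Proof.
rewrite mulnC -(bin2 m.+1) -bin2_sum -sum1_card.
under eq_bigl do rewrite inE.
rewrite -(pair_big_dep xpredT (fun i j : 'I_m => (i <= j)%N) (fun _ _ => 1%N)) /=.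
rewrite (exchange_big_dep xpredT) //= big_mkord big_ord_recl add0n; apply: eq_bigr => j _.
by rewrite (@sum_ord_lt _ j.+1).
Qed.

(* N and M; coordinates are numbered by [enum_val]. *)
Notation Ndim n := #|node_pairs n|.
Notation Mdim m := #|class_pairs m|.

(* Stacking over l: the coordinate (l, r) sits at [mxtens_index (l, r)], the
   same block-by-block ordering as in [tensmx].                             *)
Definition vectorize (R : realType) n L (T : tensor R n L) :
    'cV[R]_(L * Ndim n) :=
  \col_s let: (l, r) := mxtens_unindex s in
         T (enum_val r).1 (enum_val r).2 l.

Definition clustering_matrices m n : {set 'M[bool]_(n, m)} :=
  [set Z : 'M[bool]_(n, m) | [forall i, #|[set k | Z i k]%SET| == 1]%N]%SET.

Definition clustering_sequences m n n0 L :
    {set {ffun 'I_L -> 'M[bool]_(n, m)}} :=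
  [set Z : {ffun 'I_L -> 'M[bool]_(n, m)} |
    [forall l, Z l \in clustering_matrices m n] &&
    [forall l : 'I_L, forall l' : 'I_L, (l' == l.+1 :> nat) ==>
       (#|[set i | row i (Z l) != row i (Z l')]%SET| <= n0)%N]]%SET.

Definition clustering_block (R : realType) m n (Z : 'M[bool]_(n, m)) :
    'M[R]_(Ndim n, Mdim m) :=
  \matrix_(r, s)
    (let: (i1, i2) := enum_val r in let: (k1, k2) := enum_val s in
     (Z i1 k1 && Z i2 k2) || (Z i1 k2 && Z i2 k1))%:R.

(* E_ll (x) C^(l) is C^(l) placed in the l-th diagonal block. *)
Definition clustering_operator (R : realType) m n L
    (Z : {ffun 'I_L -> 'M[bool]_(n, m)}) : 'M[R]_(L * Ndim n, L * Mdim m) :=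
  \sum_l tensmx (delta_mx l l) (clustering_block R (Z l)).

(* W = H (x) I_M *)
Definition transform (R : realType) L (H : 'M[R]_L) m : 'M[R]_(L * Mdim m) :=
  tensmx H (1%:M : 'M[R]_(Mdim m)).

Definition restrict_to (R : realType) k (J : {set 'I_k}) (d : 'cV[R]_k) : 'cV[R]_k :=
  \col_j (if j \in J then d j ord0 else 0).

(* (m, J, d, C); [coef] is not required to vanish off [supp] here. *)
Record params (R : realType) (n L : nat) := Params {
  nclass : nat;
  supp : {set 'I_(L * Mdim nclass)};
  coef : 'cV[R]_(L * Mdim nclass);
  clust : {ffun 'I_L -> 'M[bool]_(n, nclass)} }.

Definition admissible (R : realType) n n0 L : set (params R n L) :=
  [set p | [/\ (1 <= nclass p <= n)%N, supp p != finset.set0 &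
               clust p \in clustering_sequences (nclass p) n n0 L]].

(* C W^T d *)
Definition fit (R : realType) n L (H : 'M[R]_L) m
    (Z : {ffun 'I_L -> 'M[bool]_(n, m)}) (d : 'cV[R]_(L * Mdim m)) :
    'cV[R]_(L * Ndim n) :=
  clustering_operator R Z *m (transform H m)^T *m d.

Definition criterion (R : realType) n n0 L (H : 'M[R]_L)
    (a : 'cV[R]_(L * Ndim n)) (p : params R n L) : R :=
  vnorm (a - fit H (clust p) (coef p)) ^+ 2
  + 11 * ln #|clustering_sequences (nclass p) n n0 L|%:R
  + 11 / 2 * #|supp p|%:R
      * ln (25 * (nclass p)%:R ^+ 2 * L%:R / #|supp p|%:R).

Definition penalized_lse (R : realType) n n0 L (H : 'M[R]_L)
    (a : 'cV[R]_(L * Ndim n)) (p : params R n L) : Prop :=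
  let feasible := [set p | admissible n0 p /\
                           forall j, j \notin supp p -> coef p j ord0 = 0] in
  feasible p /\ forall p', feasible p' -> criterion n0 H a p <= criterion n0 H a p'.

Definition Pen (R : realType) (n n0 L : nat) (J m : nat) : R :=
  11 * (n%:R * ln m%:R
        + (if n0 == 0 then 0
           else n0%:R * (L%:R - 1) * ln (m%:R * n%:R * expR 1 / n0%:R))
        + J%:R / 2 * ln (25 * m%:R ^+ 2 * L%:R / J%:R)).

(* Main.v *)
(* Write xi = a - theta* for the noise and, for each model (m, J, C), let V be the span of
   theta* and of the columns of C W^T indexed by J.  Bernoulli variables are subgaussian with
   variance proxy 1/4, so averaging exp<v, xi> over v Gaussian in V gives
   E exp(|P_V xi|^2) <= 2^((|J| + 1) / 2).  The sum over all models of
   2^(-(|J| + 1) / 2) |C|^-3 (25 m^2 L / |J|)^-|J| exp(|P_V xi|^2), plus 1, is a single random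
   variable T with E T <= 3, and |P_V xi|^2 <= penalty / 3 + ln T holds in every model at once.
   The basic inequality of the minimizer, with the cross term split by 2 <xi, z> <= |z|^2 / 3 +
   3 |P_V xi|^2 for the estimator and by -2 <xi, z> <= |z|^2 + |P_V xi|^2 for the oracle, then
   gives |thetahat - theta*|^2 <= 3 bias^2 + 2 penalty + 6 ln T.  Markov's inequality for T
   yields the first bound and ln T <= T the second. *)

Require Import Defs.
From HB Require Import structures.
From mathcomp Require Import all_boot all_order all_algebra.
From mathcomp Require Import mxtens.
From mathcomp Require Import all_classical all_reals all_analysis.
From mathcomp Require Import measurable_realfun.
From mathcomp Require Import ring lra zify.

Set Implicit Arguments.
Unset Strict Implicit.
Unset Printing Implicit Defensive.
Import Order.TTheory GRing.Theory Num.Theory numFieldNormedType.Exports.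
Local Open Scope classical_set_scope.
Local Open Scope ring_scope.

(** * Exponential moments *)

Lemma le_of_derive_ge0 (R : realType) (f df : R -> R) (x : R) :
  (forall y : R, is_derive y 1 f (df y)) -> (forall y, 0 <= y -> 0 <= df y) ->
  0 <= x -> f 0 <= f x.
Proof.
move=> fdf df_ge0 x_ge0; rewrite -subr_ge0.
have cont_f : {within `[0, x], continuous f}.
  by apply: derivable_within_continuous => y _; have := fdf y => fdfy; exact: ex_derive.
have [c /itvP c_in ->] := MVT_segment x_ge0 (fun y _ => fdf y) cont_f.
by rewrite mulr_ge0 ?subr_ge0// df_ge0// c_in.
Qed.

(** Hoeffding's lemma for a centred Bernoulli variable. The derivative of [ln (1 - p + p * expR x)]
    is the tilted mean [u], whose own derivative [u * (1 - u)] is at most 1/4; comparing derivatives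
    twice from 0 gives [s ^+ 2 / 8]. *)
Lemma hoeffding_bernoulli_ge0 (R : realType) (p s : R) : 0 <= p <= 1 -> 0 <= s ->
  (1 - p) * expR (- (p * s)) + p * expR ((1 - p) * s) <= expR (s ^+ 2 / 8).
Proof.
move=> /andP[p_ge0 p_le1] s_ge0.
(* At [p = 1] the centred variable is 0. Otherwise the constant part [1 - p] alone keeps the
   denominator [1 - p + p * expR x] positive. *)
have [->|p_neq1] := eqVneq p 1.
  by rewrite subrr mul0r add0r mul1r mul0r expR0 -expR0 ler_expR divr_ge0 ?sqr_ge0.
have D_gt0 (x : R) : 0 < 1 - p + p * expR x.
  by rewrite ltr_wpDr ?mulr_ge0 ?expR_ge0// subr_gt0 lt_neqAle p_neq1.
have dE (x : R) : is_derive x 1 (fun x => p * expR x) (p * expR x).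
  exact: is_deriveZ (is_derive_expR x).
have dD (x : R) : is_derive x 1 (fun x => 1 - p + p * expR x) (p * expR x).
  exact: is_derive_eq (is_deriveD (is_derive_cst (1 - p) x 1) (dE x)) (add0r _).
have tilted_mean x : 0 <= x -> p * expR x / (1 - p + p * expR x) <= p + x / 4.
  move=> x_ge0; rewrite -subr_ge0.
  pose h : R -> R := fun x => 4^-1 * x - p * expR x / (1 - p + p * expR x).
  pose dh : R -> R := fun x =>
    1 / 4 - p * (1 - p) * expR x / (1 - p + p * expR x) ^+ 2.
  suff : h 0 <= h x by rewrite /h expR0 !mulr1 subrK divr1 mulr0; lra.
  apply: (@le_of_derive_ge0 R h dh _ _ _ x_ge0) => y.
    have D_neq0 : 1 - p + p * expR y != 0 by rewrite gt_eqF.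
    have dq := is_deriveM (dE y) (@is_deriveV _ _ y _ _ D_neq0 (dD y)).
    apply: is_derive_eq (is_deriveB (is_deriveZ 4^-1 (is_derive_id y 1)) dq) _.
    rewrite /dh /GRing.scale /=; field; exact: D_neq0.
  move=> _; rewrite /dh subr_ge0 ler_pdivrMr ?exprn_gt0//.
  (* Arithmetic-geometric mean inequality for [1 - p] and [p * expR y]. *)
  by have := sqr_ge0 (1 - p - p * expR y); nra.
have : ln (1 - p + p * expR s) - p * s <= s ^+ 2 / 8.
  pose h : R -> R := fun x => 8^-1 * x ^+ 2 + p * x - ln (1 - p + p * expR x).
  pose dh : R -> R := fun x => x / 4 + p - p * expR x / (1 - p + p * expR x).
  suff : h 0 <= h s.
    by rewrite /h expR0 expr0n/= mulr1 subrK ln1 mulr0 !mulr0; lra.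
  apply: (@le_of_derive_ge0 R h dh _ _ _ s_ge0) => y.
    have D_neq0 : 1 - p + p * expR y != 0 by rewrite gt_eqF.
    have dl := @is_derive1_comp R (@ln R) (fun x => 1 - p + p * expR x) y _ _
      (is_derive1_ln (D_gt0 y)) (dD y).
    have dsq := is_deriveZ 8^-1 (is_deriveX 2 (is_derive_id y 1)).
    have dpx := is_deriveZ p (is_derive_id y 1).
    apply: is_derive_eq (is_deriveB (is_deriveD dsq dpx) dl) _.
    rewrite /dh /GRing.scale /=; field; exact: D_neq0.
  by move=> y_ge0; have := tilted_mean y y_ge0; rewrite /dh; lra.
rewrite -ler_expR expRB lnK ?posrE// => /(le_trans _); apply.
rewrite ler_pdivlMr ?expR_gt0// mulrDl -!mulrA -!expRD.
have -> : - (p * s) + p * s = 0 by ring.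
have -> : (1 - p) * s + p * s = s by ring.
by rewrite expR0 mulr1.
Qed.

(** Exchanging success and failure replaces [(p, s)] by [(1 - p, - s)], which reduces negative [s]
    to the previous case. *)
Lemma hoeffding_bernoulli (R : realType) (p s : R) : 0 <= p <= 1 ->
  (1 - p) * expR (- (p * s)) + p * expR ((1 - p) * s) <= expR (s ^+ 2 / 8).
Proof.
move=> p01; have [s_ge0|s_lt0] := leP 0 s; first exact: hoeffding_bernoulli_ge0.
have q01 : 0 <= 1 - p <= 1 by lra.
have := @hoeffding_bernoulli_ge0 R (1 - p) (- s) q01.
rewrite sqrrN (_ : 1 - (1 - p) = p); last by ring.
by rewrite !mulrN opprK addrC; apply; lra.
Qed.

(** Variance 2 makes the Gaussian moment generating function equal to [expR (y ^+ 2)]: completing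
    the square leaves this factor times the density of mean [2 * y]. *)
Lemma expR_sqr_gauss (R : realType) (y : R) :
  (\int[lebesgue_measure]_g
     (expR (g * y) * normal_pdf 0 (Num.sqrt 2) g)%:E = (expR (y ^+ 2))%:E)%E.
Proof.
have s_neq0 : Num.sqrt 2 != 0 :> R by rewrite gt_eqF ?sqrtr_gt0.
have completed_square g : expR (g * y) * normal_pdf 0 (Num.sqrt 2) g =
    expR (y ^+ 2) * normal_pdf (2 * y) (Num.sqrt 2) g.
  rewrite !normal_pdfE// mulrCA [RHS]mulrCA; congr (_ * _).
  by rewrite /normal_fun -!expRD sqr_sqrtr//; congr expR; field.
under eq_integral do rewrite completed_square EFinM.
rewrite ge0_integralZl_EFin ?expR_ge0 ?integral_normal_pdf ?mule1//.
- by move=> g _; rewrite lee_fin normal_pdf_ge0.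
- by apply/measurable_EFinP; exact: measurable_normal_pdf.
Qed.

(** The exponents add up to [g ^+ 2 / 8 - g ^+ 2 / 4 = - g ^+ 2 / 8], that of the density of
    standard deviation 2; the ratio of the two normalising constants is the factor [Num.sqrt 2] paid
    for each dimension. *)
Lemma expR_sqr8_gauss (R : realType) :
  (\int[lebesgue_measure]_g
     (expR (g ^+ 2 / 8) * normal_pdf 0 (Num.sqrt 2) g)%:E = (Num.sqrt 2 : R)%:E)%E.
Proof.
have s_neq0 : Num.sqrt 2 != 0 :> R by rewrite gt_eqF ?sqrtr_gt0.
have two_neq0 : 2 != 0 :> R by [].
have rescaled (g : R) : expR (g ^+ 2 / 8) * normal_pdf 0 (Num.sqrt 2) g =
    Num.sqrt 2 * normal_pdf 0 2 g.
  rewrite !normal_pdfE// mulrCA [RHS]mulrA; congr (_ * _); last first.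
    by rewrite /normal_fun -expRD sqr_sqrtr//; congr expR; field.
  rewrite /normal_peak sqr_sqrtr// (_ : 2 ^+ 2 * pi *+ 2 = 2 * (2 * pi *+ 2)); last by ring.
  by rewrite [X in _ = _ * X^-1]sqrtrM// invfM mulVKf.
under eq_integral do rewrite rescaled EFinM.
rewrite ge0_integralZl_EFin ?sqrtr_ge0 ?integral_normal_pdf ?mule1//.
- by move=> g _; rewrite lee_fin normal_pdf_ge0.
- by apply/measurable_EFinP; exact: measurable_normal_pdf.
Qed.

(* One coordinate of [x i] at a time: [expR (y ^+ 2)] is the mean of [expR (g * y)] for g of
   law N(0, 2), which reduces squares to the linear forms of the hypothesis. *)
Lemma gauss_mixture (R : realType) (I : finType) (w : I -> R) (r : nat)
    (x : I -> 'I_r -> R) (K : R) :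
  (forall i, 0 <= w i) ->
  (forall v : 'I_r -> R,
     \sum_i w i * expR (\sum_k v k * x i k) <= K * expR (\sum_k v k ^+ 2 / 8)) ->
  \sum_i w i * expR (\sum_k x i k ^+ 2) <= K * Num.sqrt 2 ^+ r.
Proof.
elim: r w x K => [|r IHr] w x K w_ge0 subgauss.
  have := subgauss (fun=> 0); rewrite big_ord0 expR0 expr0.
  by under eq_bigr do rewrite big_ord0; under [in X in _ -> X]eq_bigr do rewrite big_ord0.
(* With the first coefficient frozen at [g], the tilted weights satisfy the hypothesis in the other
   [r] coordinates, with constant [K * expR (g ^+ 2 / 8)]; this is why the induction generalises
   over [w] and [K]. *)
have IHg (g : R) : \sum_i w i * expR (g * x i ord0) *
      expR (\sum_(k < r) x i (lift ord0 k) ^+ 2)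
    <= K * expR (g ^+ 2 / 8) * Num.sqrt 2 ^+ r.
  apply: (IHr (fun i => w i * expR (g * x i ord0)) (fun i k => x i (lift ord0 k))).
    by move=> i; rewrite mulr_ge0 ?expR_ge0.
  move=> v; pose v' k := if unlift ord0 k is Some j then v j else g.
  have := subgauss v'.
  rewrite big_ord_recl {2}/v' unlift_none expRD mulrA.
  under eq_bigr do rewrite big_ord_recl {1}/v' unlift_none expRD mulrA.
  under eq_bigr do under eq_bigr do rewrite /v' liftK.
  by under [X in _ <= _ * expR X]eq_bigr do rewrite /v' liftK.
have K_ge0 : 0 <= K.
  have := subgauss (fun=> 0); under [X in _ <= K * expR X]eq_bigr do rewrite expr0n mul0r.
  rewrite big1_eq expR0 mulr1; apply: le_trans; apply: sumr_ge0 => i _.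
  by rewrite mulr_ge0 ?expR_ge0.
have pdf_ge0 (g : R) : 0 <= normal_pdf 0 (Num.sqrt 2) g by exact: normal_pdf_ge0.
(* The last factor [Num.sqrt 2] is turned back into an integral, so that both sides become integrals
   over [g] and [IHg] compares the integrands pointwise. *)
rewrite -lee_fin exprSr mulrA EFinM -expR_sqr8_gauss.
pose c i := w i * expR (\sum_(k < r) x i (lift ord0 k) ^+ 2).
have c_ge0 i : 0 <= c i by rewrite mulr_ge0 ?expR_ge0.
have meas_exp (a : R) : measurable_fun setT
    (fun g : R => expR (g * a) * normal_pdf 0 (Num.sqrt 2) g).
  apply: measurable_funM; last exact: measurable_normal_pdf.
  by apply: measurableT_comp => //; exact: measurable_funM.
have meas_sqr : measurable_fun setT
    (fun g : R => expR (g ^+ 2 / 8) * normal_pdf 0 (Num.sqrt 2) g).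
  apply: measurable_funM; last exact: measurable_normal_pdf.
  by apply: measurableT_comp => //; apply: measurable_funM => //; exact: measurable_funX.
have -> : ((\sum_i w i * expR (\sum_k x i k ^+ 2))%:E =
  \int[lebesgue_measure]_g
    \sum_i ((c i)%:E * (expR (g * x i ord0) * normal_pdf 0 (Num.sqrt 2) g)%:E))%E.
  rewrite ge0_integral_sum//; last 2 first.
  - by move=> i; apply: measurable_funeM; apply/measurable_EFinP; exact: meas_exp.
  - by move=> i g _; rewrite -EFinM lee_fin !mulr_ge0 ?expR_ge0 ?c_ge0 ?pdf_ge0.
  rewrite -sumEFin; apply: eq_bigr => i _.
  rewrite ge0_integralZl_EFin//; last 2 first.
  - by move=> g _; rewrite lee_fin mulr_ge0 ?expR_ge0 ?pdf_ge0.
  - by apply/measurable_EFinP; exact: meas_exp.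
  by rewrite expR_sqr_gauss -EFinM big_ord_recl expRD mulrCA mulrC.
rewrite -ge0_integralZl_EFin//; last 3 first.
- by move=> g _; rewrite lee_fin mulr_ge0 ?expR_ge0 ?pdf_ge0.
- by apply/measurable_EFinP; exact: meas_sqr.
- by rewrite mulr_ge0 ?exprn_ge0 ?sqrtr_ge0.
apply: ge0_le_integral => //.
- by move=> g _; apply: sume_ge0 => i _; rewrite -EFinM lee_fin !mulr_ge0 ?expR_ge0 ?c_ge0 ?pdf_ge0.
- by apply: emeasurable_sum => i; apply: measurable_funeM; apply/measurable_EFinP; exact: meas_exp.
- by apply: measurable_funeM; apply/measurable_EFinP; exact: meas_sqr.
move=> g _; under eq_bigr do rewrite -EFinM.
rewrite sumEFin -EFinM lee_fin mulrA.
under eq_bigr do rewrite mulrA.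
rewrite -mulr_suml ler_wpM2r// (le_trans _ (le_trans (IHg g) _))//.
  by apply: ler_sum => i _; rewrite /c mulrAC.
by rewrite mulrAC.
Qed.

(** Gram-Schmidt: the rows of [U] are orthonormal, and [U^T *m U] is a projection that fixes the
    span of [s]. A vector whose residual vanishes adds no row, whence [r <= size s] rather than
    equality. *)
Lemma orthonormal_span (R : rcfType) (N : nat) (s : seq 'cV[R]_N) :
  exists r (U : 'M[R]_(r, N)), [/\ (r <= size s)%N, U *m U^T = 1%:M &
    forall v, v \in s -> U^T *m U *m v = v].
Proof.
elim: s => [|a s [r [U [r_le UUT fixU]]]].
  by exists 0, 0; split => //; apply/matrixP => -[].
pose b := a - U^T *m U *m a.
have Ub0 : U *m b = 0.
  by rewrite /b mulmxBr !mulmxA UUT mul1mx subrr.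
have [b0|b_neq0] := eqVneq b 0.
  exists r, U; split => //; first exact: leqW.
  move=> v; rewrite inE => /predU1P[->|]; last exact: fixU.
  by apply/esym/eqP; rewrite -subr_eq0 -/b b0.
pose q := (b^T *m b) ord0 ord0.
have qE : q = \sum_i b i ord0 ^+ 2.
  by rewrite /q mxE; apply: eq_bigr => i _; rewrite mxE expr2.
have q_gt0 : 0 < q.
  rewrite lt0r qE sumr_ge0 ?andbT => [|i _]; last exact: sqr_ge0.
  apply: contra_neq b_neq0 => /eqP; rewrite psumr_eq0 => [/allP b0|i _]; last exact: sqr_ge0.
  apply/colP => i; rewrite [RHS]mxE; apply/eqP.
  by move: (b0 i (mem_index_enum _)); rewrite /= sqrf_eq0.
have bTb : b^T *m b = q%:M by rewrite [LHS]mx11_scalar.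
pose e := (Num.sqrt q)^-1 *: b.
have eT : e^T = (Num.sqrt q)^-1 *: b^T by apply/matrixP => i j; rewrite !mxE.
have eTe : e^T *m e = 1%:M.
  rewrite eT /e -scalemxAl -scalemxAr bTb scalerA -invfM -expr2 sqr_sqrtr ?ltW//.
  by rewrite -scalemx1 scalerA mulVf ?gt_eqF// scale1r.
have Ue : U *m e = 0 by rewrite /e -scalemxAr Ub0 scaler0.
have eTU : e^T *m U^T = 0 by rewrite -trmx_mul Ue trmx0.
exists (r + 1)%N, (col_mx U e^T); split.
- by rewrite addn1.
- rewrite tr_col_mx mul_col_row UUT trmxK eTe Ue.
  by rewrite eTU scalar_mx_block.
- move=> v; rewrite inE tr_col_mx trmxK mul_row_col mulmxDl => /predU1P[->|v_in]; last first.
    by rewrite -!mulmxA -[in e^T *m v](fixU v v_in) !mulmxA -(mulmxA e) eTU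
      !mulmx0 !mul0mx addr0 fixU.
  (* The part of [a] other than [b] lies in the row space of [U], to which [e] is orthogonal, so
     only [b] survives. *)
  have -> : e *m e^T *m a = b.
    have -> : a = b + U^T *m U *m a by rewrite /b subrK.
    rewrite mulmxDr -!mulmxA (mulmxA e^T U^T) eTU mul0mx mulmx0 addr0.
    rewrite eT /e -!scalemxAl -!scalemxAr bTb scalerA -invfM -expr2.
    by rewrite sqr_sqrtr ?ltW// mul_mx_scalar scalerA mulVf ?scale1r// gt_eqF.
  by rewrite /b addrC subrK.
Qed.

(** * Counting clustering sequences *)

Section chains.
Variables (X : finType) (S : {set X}) (e : rel X) (D : nat).
Hypothesis degree_le : forall x, (#|[set y in S | e x y]%SET| <= D)%N.

Definition is_chain k (f : {ffun 'I_k -> X}) :=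
  [forall i, f i \in S] &&
  [forall i : 'I_k, forall j : 'I_k, (j == i.+1 :> nat) ==> e (f i) (f j)].

(** Chains are grouped by their second entry, which has at most [D] values; once the first entry is
    fixed, a chain is determined by its tail, a shorter chain from that second entry. *)
Lemma card_chains_from k x :
  (#|[set f : {ffun 'I_k.+1 -> X} | is_chain f & f ord0 == x]%SET| <= D ^ k)%N.
Proof.
elim: k x => [|k IHk] x.
  apply/card_le1_eqP => f g; rewrite !inE => /andP[_ /eqP fx] /andP[_ /eqP gx].
  by apply/ffunP => i; rewrite ord1 fx.
pose one : 'I_k.+2 := lift ord0 ord0.
rewrite -sum1_card (partition_big (fun f : {ffun 'I_k.+2 -> X} => f one)
  (fun y => y \in [set y in S | e x y]%SET)) /=; last first.
  move=> f; rewrite !inE => /andP[/andP[/forallP fS /forallP fe] /eqP <-].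
  by rewrite fS; move/forallP: (fe ord0) => /(_ one) /implyP; apply.
rewrite expnS (leq_trans (n := \sum_(y in [set y in S | e x y]%SET) D ^ k))//; last first.
  by rewrite sum_nat_const leq_mul2r degree_le orbT.
apply: leq_sum => y _; rewrite sum1_card (leq_trans _ (IHk y))//.
pose tail (f : {ffun 'I_k.+2 -> X}) := [ffun i : 'I_k.+1 => f (lift ord0 i)].
rewrite -[leqLHS](@card_in_imset _ _ tail); last first.
  move=> f g; rewrite unfold_in inE => /andP[/andP[_ /eqP f0] _].
  rewrite unfold_in inE => /andP[/andP[_ /eqP g0] _] /ffunP fg.
  apply/ffunP => i; case: (unliftP ord0 i) => [j ->|->]; last by rewrite f0 g0.
  by have := fg j; rewrite !ffunE.
apply: subset_leq_card; apply/fintype.subsetP => _ /imsetP[f + ->].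
rewrite unfold_in !inE ffunE => /andP[/andP[/andP[/forallP fS /forallP fe] _] ->].
rewrite andbT; apply/andP; split; apply/forallP => i; first by rewrite ffunE.
apply/forallP => j; apply/implyP => /eqP ij; rewrite !ffunE.
by move/forallP: (fe (lift ord0 i)) => /(_ (lift ord0 j)) /implyP; apply; rewrite !lift0 ij.
Qed.

Lemma card_chains k : (#|[set f : {ffun 'I_k.+1 -> X} | is_chain f]%SET| <= #|S| * D ^ k)%N.
Proof.
rewrite -sum1_card (partition_big (fun f : {ffun 'I_k.+1 -> X} => f ord0) (mem S)) /=; last first.
  by move=> f; rewrite inE => /andP[/forallP fS _].
rewrite -sum_nat_const; apply: leq_sum => x _; rewrite sum1_card.
rewrite (leq_trans _ (card_chains_from k x))//.
by apply: subset_leq_card; apply/fintype.subsetP => f; rewrite unfold_in !inE.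
Qed.

End chains.

Lemma exists_superset_card (T : finType) (A : {set T}) k :
  (#|A| <= k <= #|T|)%N -> exists2 B : {set T}, A \subset B & #|B| = k.
Proof.
move=> /andP[]; elim: k => [|k IHk] A_le k_le.
  by exists A => //; apply/eqP; rewrite -leqn0.
move: A_le; rewrite leq_eqVlt => /predU1P[Ak|]; first by exists A.
rewrite ltnS => /IHk /(_ (ltnW k_le)) [B AB Bk].
have /set0Pn[x xB] : ~: B != finset.set0.
  by rewrite -card_gt0 -(ltn_add2l #|B|) addn0 cardsC Bk.
exists (x |: B); first by rewrite finset.subsetU// AB orbT.
by rewrite cardsU1 -finset.in_setC xB Bk.
Qed.

Definition unit_rows m : {set 'rV[bool]_m} := [set \row_k (k == j) | j : 'I_m]%SET.

Lemma card_unit_rows m : (#|unit_rows m| <= m)%N.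
Proof. by rewrite (leq_trans (leq_imset_card _ _))// card_ord. Qed.

Lemma row_clustering m n (Z : 'M[bool]_(n, m)) i :
  Z \in clustering_matrices m n -> row i Z \in unit_rows m.
Proof.
rewrite inE => /forallP /(_ i) /cards1P[j Zj].
apply/imsetP; exists j => //; apply/rowP => k; rewrite !mxE.
by have /setP /(_ k) := Zj; rewrite !inE.
Qed.

(** Rows outside [F] are copied from [Z0] and each row in [F] is one of at most [m] unit rows. [Z0]
    is arbitrary, so taking [F] full counts all clustering matrices. *)
Lemma card_clustering_agree m n (Z0 : 'M[bool]_(n, m)) (F : {set 'I_n}) :
  (#|[set Z in clustering_matrices m n | [forall i, (i \notin F) ==> (row i Z0 == row i Z)]]%SET|
   <= m ^ #|F|)%N.
Proof.
pose rows (Z : 'M[bool]_(n, m)) := [ffun i => row i Z].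
rewrite -(card_imset _ (f := rows)); last first.
  by move=> Z Z' /ffunP ZZ'; apply/row_matrixP => i; have := ZZ' i; rewrite !ffunE.
pose G i : pred 'rV[bool]_m :=
  fun x => if i \in F then x \in unit_rows m else x == row i Z0.
apply: (@leq_trans #|family G|).
  apply: subset_leq_card; apply/fintype.subsetP => _ /imsetP[Z + ->].
  rewrite inE => /andP[Zc /forallP ZF].
  apply/familyP => i; rewrite ffunE unfold_in /G; case: ifPn => [_|iF]; first exact: row_clustering.
  by have := ZF i; rewrite iF /= eq_sym.
rewrite card_family foldrE big_map big_enum /=.
rewrite (bigID (mem F)) /= [X in (_ * X)%N]big1 ?muln1; last first.
  move=> i /negPf iF; apply: etrans (card1 (row i Z0)); apply: eq_card => x.
  by rewrite unfold_in /G iF.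
rewrite -prod_nat_const; apply: leq_prod => i iF.
rewrite (leq_trans _ (card_unit_rows m))// subset_leq_card//.
by apply/fintype.subsetP => x; rewrite unfold_in /G iF.
Qed.

Lemma card_clustering_matrices m n : (#|clustering_matrices m n| <= m ^ n)%N.
Proof.
have := @card_clustering_agree m n (const_mx false) [set: 'I_n]%SET.
rewrite cardsT card_ord; apply: leq_trans.
apply: subset_leq_card; apply/fintype.subsetP => Z Zc; rewrite inE Zc /=.
by apply/forallP => i; rewrite finset.in_setT.
Qed.

(** The set of changed rows is enlarged to exactly [n0] rows, so one binomial coefficient suffices
    instead of a sum over all sizes up to [n0]. *)
Lemma card_clustering_ball m n n0 (Z0 : 'M[bool]_(n, m)) : (n0 <= n)%N ->
  (#|[set Z in clustering_matrices m n |
      (#|[set i | row i Z0 != row i Z]%SET| <= n0)%N]%SET| <= 'C(n, n0) * m ^ n0)%N.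
Proof.
move=> n0n.
have <- : #|[set F : {set 'I_n} | #|F| == n0]%SET| = 'C(n, n0) by rewrite card_draws card_ord.
rewrite -sum_nat_const.
apply: (@leq_trans (\sum_(F : {set 'I_n} | F \in [set F : {set 'I_n} | #|F| == n0]%SET)
   #|[set Z in clustering_matrices m n | [forall i, (i \notin F) ==> (row i Z0 == row i Z)]]%SET|));
  last first.
  apply: leq_sum => F; rewrite inE => /eqP <-; exact: card_clustering_agree.
under eq_bigr do rewrite -sum1_card big_mkcond.
rewrite exchange_big /= -sum1_card big_mkcond; apply: leq_sum => Z _.
case: ifP => //; rewrite inE => /andP[Zc Zn0].
have [|F AF Fn0] := @exists_superset_card _ [set i | row i Z0 != row i Z]%SET n0.
  by rewrite Zn0 card_ord.
rewrite (bigD1 F) /=; last by rewrite inE Fn0.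
rewrite ifT// inE Zc /=.
apply/forallP => i; apply/implyP; apply: contraR => iZ.
by apply: (fintype.subsetP AF); rewrite inE.
Qed.

(** Clustering sequences are chains for the relation of differing in at most [n0] rows: a free first
    matrix, then [L] transitions between [L.+1] instants. *)
Lemma card_clustering_sequences m n n0 L : (n0 <= n)%N ->
  (#|clustering_sequences m n n0 L.+1| <= m ^ n * ('C(n, n0) * m ^ n0) ^ L)%N.
Proof.
move=> n0n.
pose e (Z Z' : 'M[bool]_(n, m)) := (#|[set i | row i Z != row i Z']%SET| <= n0)%N.
have ball_le Z := @card_clustering_ball m n n0 Z n0n.
apply: leq_trans (_ : _ <= #|[set Z : {ffun 'I_L.+1 -> 'M[bool]_(n, m)} |
  is_chain (clustering_matrices m n) e Z]%SET|)%N _.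
  by apply: subset_leq_card; apply/fintype.subsetP => Z; rewrite !inE.
apply: leq_trans (card_chains ball_le _) _.
by rewrite leq_mul2r card_clustering_matrices orbT.
Qed.

(** Witnessed by the [m] constant sequences that put all nodes in one class. It lets inverse powers
    of the cardinality pay for the sum over [m]. *)
Lemma card_clustering_sequences_ge m n n0 L : (0 < n)%N -> (0 < L)%N ->
  (m <= #|clustering_sequences m n n0 L|)%N.
Proof.
move=> n_gt0 L_gt0.
pose cst_seq (k : 'I_m) := [ffun _ : 'I_L => \matrix_(i < n, j < m) (j == k)].
have cst_inj : injective cst_seq.
  move=> k k' /ffunP /(_ (Ordinal L_gt0)); rewrite !ffunE.
  move=> /matrixP /(_ (Ordinal n_gt0) k); rewrite !mxE eqxx.
  by move=> /esym /eqP.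
rewrite -{1}(card_ord m) -(card_imset _ cst_inj).
apply: subset_leq_card; apply/fintype.subsetP => _ /imsetP[k _ ->]; rewrite inE.
apply/andP; split.
  apply/forallP => l; rewrite ffunE inE; apply/forallP => i.
  by apply/cards1P; exists k; apply/setP => j; rewrite !inE mxE.
apply/forallP => l; apply/forallP => l'; apply/implyP => _; rewrite !ffunE.
rewrite (_ : finset _ = finset.set0) ?cards0//.
by apply/setP => i; rewrite !inE eqxx.
Qed.

(** * Numerical bounds for the sums over models *)

Lemma expn_le_fact_expR (R : realType) j : j%:R ^+ j <= j`!%:R * expR j%:R :> R.
Proof.
case: j => [|j]; first by rewrite expr0 mul1r expR0.
(* A single term of the exponential series at [j.+1] gives the bound. *)
have := @expR_ge1Dxn R j.+1%:R j (ler0n _ _).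
rewrite -ler_pdivrMl ?ltr0n ?fact_gt0// mulrC => h.
by apply: le_trans h; rewrite lerDr.
Qed.

(** The usual bound of the binomial coefficient by [(K * e / j) ^ j], free of division so that
    [j = 0] is covered. *)
Lemma bin_expR_le (R : realType) K j :
  'C(K, j)%:R * j%:R ^+ j <= (K%:R * expR 1) ^+ j :> R.
Proof.
have ffact_le : 'C(K, j)%:R * j`!%:R <= K%:R ^+ j :> R.
  rewrite -natrM bin_ffact -natrX ler_nat.
  elim: j => [|j IHj]; first by rewrite ffactn0.
  by rewrite ffactnSr expnSr leq_mul// leq_subr.
rewrite exprMn -expRM_natl mulr1.
apply: le_trans (ler_wpM2r (expR_ge0 _) ffact_le).
by rewrite -mulrA ler_wpM2l// expn_le_fact_expR.
Qed.

Lemma expR1_le4 (R : realType) : expR 1 <= 4 :> R.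
Proof.
have h : expR (2^-1) <= 2 :> R.
  rewrite -[leLHS]invrK -expRN -[leRHS]invrK lef_pV2 ?posrE ?invr_gt0 ?expR_gt0//.
  by rewrite (le_trans _ (expR_ge1Dx _))//; lra.
rewrite (_ : 1 = 2^-1 + 2^-1 :> R); last by field.
by rewrite expRD; have := expR_gt0 (2^-1 : R); nra.
Qed.

Lemma sum_invsqr_le2 (R : realType) n : \sum_(m < n) m.+1%:R ^- 2 <= 2 :> R.
Proof.
(* Strengthened for the induction: each new term is at most the telescoping difference of
   consecutive inverses. *)
suff : \sum_(m < n.+1) m.+1%:R ^- 2 <= 2 - n.+1%:R^-1 :> R.
  rewrite big_ord_recr /= => sum_le; apply: le_trans (le_trans sum_le _).
    by rewrite lerDl invr_ge0 exprn_ge0.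
  by rewrite gerBl invr_ge0.
elim: n => [|n IHn]; first by rewrite big_ord1 expr1n invr1; lra.
rewrite big_ord_recr /=.
have n_gt0 : 0 < n.+1%:R :> R by rewrite ltr0n.
rewrite -[n.+2%:R]natr1; set x : R := n.+1%:R in n_gt0 IHn *.
have -> : (x + 1) ^- 2 = x^-1 - (x + 1)^-1 - (x * (x + 1) ^+ 2)^-1.
  by field; lra.
apply: le_trans (lerD IHn (lexx _)) _.
rewrite addrA [2 - _ + _]addrA subrK gerBl invr_ge0 mulr_ge0 ?exprn_ge0//; lra.
Qed.

(** Grouping by size, the subsets with [j] elements contribute at most
    ['C(K, j) * (25 * X / j) ^- j <= 2 ^- j], and the geometric series from [j = 1] is at most 1. *)
Lemma sum_subsets_le1 (R : realType) K (X : R) : K%:R <= X ->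
  \sum_(J : {set 'I_K} | J != finset.set0)
     expR (- (#|J|%:R * ln (25 * X / #|J|%:R))) <= 1.
Proof.
move=> KX.
pose f j : R := expR (- (j%:R * ln (25 * X / j%:R))).
have card_lt (J : {set 'I_K}) : (#|J| < K.+1)%N.
  by rewrite ltnS (leq_trans (max_card _))// card_ord.
rewrite (partition_big (fun J : {set 'I_K} => Ordinal (card_lt J)) (fun j => j != ord0)) /=;
  last by move=> J; rewrite -card_gt0 -lt0n.
have f_le (j : 'I_K.+1) : j != ord0 -> 'C(K, j)%:R * f j <= 2^-1 ^+ j.
  rewrite -val_eqE -lt0n /= => j_gt0.
  have jR_gt0 : 0 < j%:R :> R by rewrite ltr0n.
  have K_gt0 : 0 < K%:R :> R by rewrite ltr0n; have := ltn_ord j; lia.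
  have X_gt0 : 0 < X by exact: lt_le_trans KX.
  have q_gt0 : 0 < 25 * X / j%:R by rewrite divr_gt0// mulr_gt0.
  rewrite /f expRN expRM_natl lnK ?posrE// expr_div_n invf_div mulrA.
  rewrite ler_pdivrMr ?exprn_gt0 ?mulr_gt0// (le_trans (bin_expR_le _ _ _))//.
  rewrite -exprMn lerXn2r ?nnegrE ?mulr_ge0 ?expR_ge0 ?ltW//.
  (* Since [K <= X], what is required is e at most 25/2, and the crude bound 4 is enough. *)
  by have := expR1_le4 R; have := expR_gt0 (1 : R); nra.
rewrite (@le_trans _ _ (\sum_(j < K.+1 | j != ord0) 2^-1 ^+ j))//.
  apply: ler_sum => j j_neq0; apply: le_trans (f_le j j_neq0).
  have <- : #|[set J : {set 'I_K} | #|J| == j]%SET| = 'C(K, j).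
    by rewrite card_draws card_ord.
  rewrite [leRHS]mulr_natl -[leRHS]sumr_const.
  rewrite le_eqVlt; apply/orP; left; apply/eqP.
  apply: eq_big => J.
    rewrite inE; apply/andP/eqP => [[_ /eqP <-]//|Jj].
    by split; [rewrite -card_gt0 Jj lt0n | apply/eqP/val_inj].
  by move=> /andP[_ /eqP <-].
rewrite big_mkcond big_ord_recl /= add0r.
suff -> : \sum_(i < K) 2^-1 ^+ (lift ord0 i) = 1 - 2^-1 ^+ K :> R.
  by rewrite gerBl exprn_ge0.
elim: K {KX f card_lt f_le} => [|K IHK]; first by rewrite big_ord0 expr0 subrr.
rewrite big_ord_recr /= IHK /bump /= add1n exprS; lra.
Qed.

(** Logarithm of the count of chains, with the binomial coefficient bounded by [bin_expR_le]. When
    [n0 = 0] every transition is counted once, which matches the zero term of [Pen]. *)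
Lemma ln_card_clustering_sequences (R : realType) m n n0 L :
  (0 < m)%N -> (0 < n)%N -> (0 < L)%N -> (n0 <= n)%N ->
  ln #|clustering_sequences m n n0 L|%:R <=
  n%:R * ln m%:R + (if n0 == 0 then 0
    else n0%:R * (L%:R - 1) * ln (m%:R * n%:R * expR 1 / n0%:R)) :> R.
Proof.
move=> m_gt0 n_gt0 L_gt0 n0n.
have card_gt0 : (0 < #|clustering_sequences m n n0 L|)%N.
  exact: leq_trans m_gt0 (card_clustering_sequences_ge m n0 n_gt0 L_gt0).
case: L L_gt0 card_gt0 => // L _ card_gt0.
have mR_gt0 : 0 < m%:R :> R by rewrite ltr0n.
have nR_gt0 : 0 < n%:R :> R by rewrite ltr0n.
rewrite -natr1 addrK.
apply: (@le_trans _ _ (ln (m ^ n * ('C(n, n0) * m ^ n0) ^ L)%:R)).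
  by rewrite ler_ln ?posrE ?ltr0n ?muln_gt0 ?expn_gt0 ?muln_gt0 ?m_gt0 ?bin_gt0 ?n0n
    ?expn_gt0 ?m_gt0// ler_nat card_clustering_sequences.
rewrite natrM lnM ?posrE ?ltr0n ?expn_gt0 ?muln_gt0 ?bin_gt0 ?n0n ?expn_gt0 ?m_gt0//.
have lnX k j : (0 < k)%N -> ln (k ^ j)%:R = j%:R * ln k%:R :> R.
  by move=> k_gt0; rewrite natrX lnXn ?ltr0n// mulr_natl.
rewrite !lnX ?muln_gt0 ?bin_gt0 ?n0n ?expn_gt0 ?m_gt0// lerD2l.
case: eqP => [->|/eqP n0_neq0].
  by rewrite bin0 expn0 muln1 ln1 mulr0.
have n0R_gt0 : 0 < n0%:R :> R by rewrite ltr0n lt0n.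
rewrite mulrAC [_ * L%:R]mulrC ler_wpM2l//.
have q_gt0 : 0 < m%:R * n%:R * expR 1 / n0%:R :> R by rewrite divr_gt0 ?mulr_gt0 ?expR_gt0.
rewrite [leRHS]mulr_natl -[leRHS]lnXn// ler_ln ?posrE ?exprn_gt0//; last first.
  by rewrite ltr0n muln_gt0 bin_gt0 n0n expn_gt0 m_gt0.
rewrite expr_div_n ler_pdivlMr ?exprn_gt0// -mulrA exprMn natrM natrX mulrAC mulrC.
by rewrite ler_wpM2l ?exprn_ge0// bin_expR_le.
Qed.

(** * The oracle inequality *)

Section bernoulli_vectors.
Variables (R : realType) (N : nat) (theta : 'cV[R]_N).
Hypothesis theta01 : forall s, 0 <= theta s ord0 <= 1.

(** The probability of the outcome [b] under independent coordinates of means [theta]. Expectations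
    are finite sums with these weights until the observations themselves enter. *)
Definition bernoulli_weight (b : {ffun 'I_N -> bool}) : R :=
  \prod_s (if b s then theta s ord0 else 1 - theta s ord0).

Definition noise (b : {ffun 'I_N -> bool}) : 'cV[R]_N :=
  \col_s (b s)%:R - theta.

Lemma bernoulli_weight_ge0 b : 0 <= bernoulli_weight b.
Proof.
by apply: prodr_ge0 => s _; case: ifP => _; have := theta01 s; lra.
Qed.

(** Independence in finite form: distributivity turns the mean of a product into the product of the
    means. *)
Lemma sum_bernoulli_weight_prod (g : 'I_N -> bool -> R) :
  \sum_b bernoulli_weight b * \prod_s g s (b s) =
  \prod_s ((1 - theta s ord0) * g s false + theta s ord0 * g s true).
Proof.
pose F s (x : bool) := (if x then theta s ord0 else 1 - theta s ord0) * g s x.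
transitivity (\sum_(b : {ffun 'I_N -> bool}) \prod_s F s (b s)).
  by apply: eq_bigr => b _; rewrite big_split.
rewrite -bigA_distr_bigA.
by apply: eq_bigr => s _; rewrite big_bool /= addrC.
Qed.

Lemma sum_bernoulli_weight : \sum_b bernoulli_weight b = 1.
Proof.
transitivity (\prod_s ((1 - theta s ord0) * 1 + theta s ord0 * 1)); last first.
  by apply: big1 => s _; rewrite !mulr1 subrK.
rewrite -(sum_bernoulli_weight_prod (fun _ _ => 1)).
by apply: eq_bigr => b _; rewrite big1 ?mulr1.
Qed.

Lemma noise_mgf (c : 'I_N -> R) :
  \sum_b bernoulli_weight b * expR (\sum_s c s * noise b s ord0) <=
  expR (\sum_s c s ^+ 2 / 8).
Proof.
under eq_bigr do rewrite expR_sum.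
under eq_bigr => b _.
  under eq_bigr => s _ do rewrite /noise 2!mxE [X in _ + X]mxE.
  over.
rewrite (sum_bernoulli_weight_prod (fun s x => expR (c s * (x%:R - theta s ord0)))).
rewrite expR_sum; apply: ler_prod => s _; apply/andP; split.
  by rewrite addr_ge0// mulr_ge0 ?expR_ge0//; have := theta01 s; lra.
apply: le_trans (hoeffding_bernoulli (c s) (theta01 s)).
by rewrite add0r mulrN [c s * theta _ _]mulrC [c s * _]mulrC.
Qed.

(** A linear form [v] in the projected noise is the form [v *m U] in the noise itself, with the same
    Euclidean norm because the rows of [U] are orthonormal; [gauss_mixture] then applies with
    [K = 1]. *)
Lemma projected_noise_mgf r (U : 'M[R]_(r, N)) : U *m U^T = 1%:M ->
  \sum_b bernoulli_weight b * expR (\sum_k (U *m noise b) k ord0 ^+ 2)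
  <= Num.sqrt 2 ^+ r.
Proof.
move=> UUT; rewrite -[leRHS]mul1r.
apply: (gauss_mixture (x := fun b k => (U *m noise b) k ord0)).
  exact: bernoulli_weight_ge0.
move=> v; rewrite mul1r; pose vU := (\row_k v k) *m U.
have vU_norm : \sum_s vU ord0 s ^+ 2 / 8 = \sum_k v k ^+ 2 / 8.
  rewrite -!mulr_suml; congr (_ / _).
  transitivity ((vU *m vU^T) ord0 ord0).
    by rewrite mxE; apply: eq_bigr => s _; rewrite [vU^T _ _]mxE expr2.
  rewrite /vU trmx_mul mulmxA -[_ *m U *m _]mulmxA UUT mulmx1 mxE.
  by apply: eq_bigr => k _; rewrite !mxE expr2.
rewrite -vU_norm; apply: le_trans (noise_mgf (fun s => vU ord0 s)).
rewrite le_eqVlt; apply/orP; left; apply/eqP; apply: eq_bigr => b _.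
congr (_ * expR _); transitivity ((vU *m noise b) ord0 ord0); last by rewrite mxE.
by rewrite /vU -mulmxA [RHS]mxE; apply: eq_bigr => k _; rewrite [in RHS]mxE.
Qed.

(** [Q b] is the squared norm of the projection of the noise onto the span of [theta] and the
    columns of [M] in [J], of dimension at most [#|J|.+1]. Every [z] lies in this span, so the cross
    term only sees the projected noise, and a square completed in each coordinate gives the
    bound. *)
Lemma exists_noise_bound k (M : 'M[R]_(N, k)) (J : {set 'I_k}) :
  exists Q : {ffun 'I_N -> bool} -> R,
    \sum_b bernoulli_weight b * expR (Q b) <= Num.sqrt 2 ^+ #|J|.+1 /\
    forall b (d : 'cV[R]_k), (forall j, j \notin J -> d j ord0 = 0) ->
    forall c : R, let z := M *m d - theta in
      2 * c * \sum_s noise b s ord0 * z s ord0 <= c ^+ 2 * \sum_s z s ord0 ^+ 2 + Q b.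
Proof.
have [r [U [r_le UUT fixU]]] := orthonormal_span (theta :: [seq col j M | j <- enum J]).
exists (fun b => \sum_i (U *m noise b) i ord0 ^+ 2); split.
  apply: le_trans (projected_noise_mgf UUT) _.
  rewrite ler_weXn2l//; last by rewrite (leq_trans r_le)//= size_map -cardE.
  by rewrite -[leLHS]sqrtr1 ler_sqrt// ler1n.
move=> b d dJ c /=; set z := M *m d - theta.
have z_fix : U^T *m (U *m z) = z.
  rewrite mulmxA /z mulmxBr (fixU theta) ?mem_head//; congr (_ - _).
  have -> : M *m d = \sum_(j in J) d j ord0 *: col j M.
    rewrite [RHS]big_mkcond /=; apply/colP => s; rewrite mxE summxE.
    apply: eq_bigr => j _; case: ifPn => [_|/dJ ->]; last by rewrite mulr0 mxE.
    by rewrite !mxE mulrC.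
  rewrite mulmx_sumr; apply: eq_bigr => j jJ.
  rewrite -scalemxAr fixU// inE; apply/orP; right; apply: map_f.
  by rewrite mem_enum.
have dotU : \sum_s noise b s ord0 * z s ord0 =
    \sum_i (U *m noise b) i ord0 * (U *m z) i ord0.
  transitivity (((noise b)^T *m z) ord0 ord0).
    by rewrite mxE; apply: eq_bigr => s _; rewrite [in RHS]mxE.
  have -> : (noise b)^T *m z = (U *m noise b)^T *m (U *m z).
    by rewrite trmx_mul -mulmxA z_fix.
  rewrite mxE.
  by apply: eq_bigr => i _; rewrite [in LHS]mxE.
have normU : \sum_s z s ord0 ^+ 2 = \sum_i (U *m z) i ord0 ^+ 2.
  transitivity ((z^T *m z) ord0 ord0).
    by rewrite mxE; apply: eq_bigr => s _; rewrite [in RHS]mxE expr2.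
  have -> : z^T *m z = (U *m z)^T *m (U *m z) by rewrite trmx_mul -mulmxA z_fix.
  rewrite mxE.
  by apply: eq_bigr => i _; rewrite [in LHS]mxE expr2.
rewrite dotU normU !mulr_sumr -big_split /=; apply: ler_sum => i _.
rewrite -subr_ge0.
by have := sqr_ge0 (c * (U *m z) i ord0 - (U *m noise b) i ord0); nra.
Qed.

End bernoulli_vectors.

Lemma vnorm_sqr (R : realType) k (x : 'cV[R]_k) : vnorm x ^+ 2 = \sum_i x i ord0 ^+ 2.
Proof. by rewrite sqr_sqrtr// sumr_ge0// => i _; exact: sqr_ge0. Qed.

(** The penalty of [criterion], with the exact cardinality; [Pen] replaces its logarithm by an
    explicit upper bound. *)
Definition penalty_of (R : realType) n n0 L m j : R :=
  11 * ln #|clustering_sequences m n n0 L|%:R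
  + 11 / 2 * j%:R * ln (25 * m%:R ^+ 2 * L%:R / j%:R).

Lemma penalty_of_le_Pen (R : realType) n n0 L m j :
  (0 < m)%N -> (0 < n)%N -> (0 < L)%N -> (n0 <= n)%N ->
  penalty_of R n n0 L m j <= Pen R n n0 L j m.
Proof.
move=> m_gt0 n_gt0 L_gt0 n0n; rewrite /penalty_of /Pen.
by have := @ln_card_clustering_sequences R m n n0 L m_gt0 n_gt0 L_gt0 n0n; lra.
Qed.

Lemma Mdim_le m : (Mdim m <= m ^ 2)%N.
Proof.
rewrite card_class_pairs -mulnn; apply: leq_trans (half_leq (n := (m * m).*2) _) _.
  by rewrite mulnS; have := leq_pmulr m (n := m); case: m => [|m] // /(_ isT); lia.
by rewrite doubleK.
Qed.

(** * One random bound valid in all models at once *)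

Section envelope.
Variables (R : realType) (n L n0 : nat) (H : 'M[R]_L) (theta : 'cV[R]_(L * Ndim n)).
Hypotheses (theta01 : forall s, 0 <= theta s ord0 <= 1).
Hypotheses (n_gt0 : (0 < n)%N) (L_gt0 : (0 < L)%N).

Local Notation ell m j := (ln (25 * m%:R ^+ 2 * L%:R / j%:R) : R).
Local Notation lnC m := (ln #|clustering_sequences m n n0 L|%:R : R).

Lemma ln_card_ge0 m : (0 < m)%N -> 0 <= lnC m.
Proof.
move=> m_gt0; rewrite ln_ge0// ler1n.
exact: leq_trans m_gt0 (card_clustering_sequences_ge m n0 n_gt0 L_gt0).
Qed.

(** Holds because [#|J| <= L * Mdim m <= m ^ 2 * L]. *)
Lemma ell_ge m (J : {set 'I_(L * Mdim m)}) : J != finset.set0 -> ln 25 <= ell m #|J|.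
Proof.
rewrite -card_gt0 => J_gt0.
have JR_gt0 : 0 < #|J|%:R :> R by rewrite ltr0n.
have J_le : #|J|%:R <= m%:R ^+ 2 * L%:R :> R.
  rewrite -natrX -natrM ler_nat (leq_trans (max_card _))// card_ord mulnC.
  by rewrite leq_mul2r Mdim_le orbT.
rewrite ler_ln ?posrE//; last by rewrite divr_gt0// -mulrA mulr_gt0// (lt_le_trans JR_gt0).
by rewrite ler_pdivlMr// -mulrA ler_wpM2l.
Qed.

(* Used with [c] = 1/3 for the estimator and [c] = -1 for the oracle. *)
Lemma exists_envelope : exists T : {ffun 'I_(L * Ndim n) -> bool} -> R,
  [/\ forall b, 1 <= T b,
      \sum_b bernoulli_weight theta b * T b <= 3 &
      forall b m (J : {set 'I_(L * Mdim m)}) Z (d : 'cV[R]_(L * Mdim m)) (c : R),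
        (0 < m <= n)%N -> J != finset.set0 -> Z \in clustering_sequences m n n0 L ->
        (forall j, j \notin J -> d j ord0 = 0) ->
        let z := fit H Z d - theta in
        2 * c * \sum_s noise theta b s ord0 * z s ord0 <=
        c ^+ 2 * \sum_s z s ord0 ^+ 2 + (penalty_of R n n0 L m #|J| / 3 + ln (T b))].
Proof.
pose Q m (Z : {ffun 'I_L -> 'M[bool]_(n, m)}) (J : {set 'I_(L * Mdim m)}) := sval (cid
  (exists_noise_bound theta01 (clustering_operator R Z *m (transform H m)^T) J)).
have Q_mgf m Z (J : {set 'I_(L * Mdim m)}) :
    \sum_b bernoulli_weight theta b * expR (@Q m Z J b) <= Num.sqrt 2 ^+ #|J|.+1.
  by rewrite /Q; case: cid => ? [].
have Q_bound m Z (J : {set 'I_(L * Mdim m)}) b (d : 'cV[R]_(L * Mdim m)) c :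
    (forall j, j \notin J -> d j ord0 = 0) -> let z := fit H Z d - theta in
    2 * c * \sum_s noise theta b s ord0 * z s ord0 <= c ^+ 2 * \sum_s z s ord0 ^+ 2 + Q m Z J b.
  by move=> dJ; rewrite /Q; case: cid => q /= [_ q_bound]; exact: q_bound.
pose h : R := ln (Num.sqrt 2).
have sqrt2_gt0 : 0 < Num.sqrt 2 :> R by rewrite sqrtr_gt0.
have expRh : expR h = Num.sqrt 2 by rewrite lnK ?posrE.
(* The term in [h] cancels the moment bound for [Q], and the term in [ell] pays for the sum over
   [J]. Of the three copies of [lnC m], one pays for the sum over [Z]; the other two leave an
   inverse square of the cardinality, at most [m ^- 2], to pay for the sum over [m]. *)
pose t m Z (J : {set 'I_(L * Mdim m)}) b :=
  expR (@Q m Z J b - #|J|.+1%:R * h - 3 * lnC m - #|J|%:R * ell m #|J|).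
pose T b := 1 + \sum_(k < n) \sum_(Z in clustering_sequences k.+1 n n0 L)
  \sum_(J : {set 'I_(L * Mdim k.+1)} | J != finset.set0) t k.+1 Z J b.
have t_ge0 m Z J b : 0 <= t m Z J b by exact: expR_ge0.
have T_ge1 b : 1 <= T b.
  by rewrite lerDl sumr_ge0// => k _; rewrite sumr_ge0// => Z _; rewrite sumr_ge0.
exists T; split => //.
- have t_mgf m Z (J : {set 'I_(L * Mdim m)}) : \sum_b bernoulli_weight theta b * t m Z J b <=
      expR (- (3 * lnC m)) * expR (- (#|J|%:R * ell m #|J|)).
    have tE b : t m Z J b = expR (Q m Z J b) *
        (Num.sqrt 2 ^- #|J|.+1 * (expR (- (3 * lnC m)) * expR (- (#|J|%:R * ell m #|J|)))).
      by rewrite -expRh -expRM_natl -expRN -!expRD /t; congr expR; ring.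
    under eq_bigr do rewrite tE mulrA.
    rewrite -mulr_suml mulrA -[leRHS]mul1r ler_wpM2r ?mulr_ge0 ?expR_ge0//.
    by rewrite ler_pdivrMr ?exprn_gt0// mul1r.
  (* 1 comes from the constant term of [T] and 2 bounds the sum of inverse squares. *)
  have -> : 3 = 1 + 2 :> R by ring.
  rewrite /T; under eq_bigr do rewrite mulrDr mulr1.
  rewrite big_split /= sum_bernoulli_weight lerD2l.
  apply: le_trans (sum_invsqr_le2 R n).
  under eq_bigr do rewrite mulr_sumr.
  rewrite exchange_big; apply: ler_sum => k _ /=.
  have C_ge := card_clustering_sequences_ge k.+1 n0 n_gt0 L_gt0.
  have C_gt0 : 0 < #|clustering_sequences k.+1 n n0 L|%:R :> R.
    by rewrite ltr0n (leq_trans _ C_ge).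
  apply: (@le_trans _ _ (#|clustering_sequences k.+1 n n0 L|%:R ^- 2)); last first.
    by rewrite lef_pV2 ?posrE ?exprn_gt0// lerXn2r ?nnegrE ?ler0n// ler_nat.
  under eq_bigr do rewrite mulr_sumr.
  rewrite exchange_big /=.
  apply: (@le_trans _ _ (\sum_(Z in clustering_sequences k.+1 n n0 L) expR (- (3 * lnC k.+1)))).
    apply: ler_sum => Z _.
    under eq_bigr do rewrite mulr_sumr.
    rewrite exchange_big /= -[leRHS]mulr1.
    have K_le : (L * Mdim k.+1)%:R <= k.+1%:R ^+ 2 * L%:R :> R.
      by rewrite -natrX -natrM ler_nat mulnC leq_mul2r Mdim_le orbT.
    apply: le_trans (ler_wpM2l (expR_ge0 _) (sum_subsets_le1 K_le)).
    rewrite mulr_sumr; apply: ler_sum => J _.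
    by rewrite [25 * (_ * _)]mulrA; exact: t_mgf.
  rewrite sumr_const -[leLHS]mulr_natl expRN expRM_natl lnK ?posrE//.
  by rewrite exprSr invfM mulrCA divff ?mulr1 ?gt_eqF.
- move=> b m J Z d c /andP[m_gt0 m_le] J_neq0 ZC dJ.
  apply: le_trans (Q_bound m Z J b d c dJ) _; rewrite lerD2l.
  have t_le : t m Z J b <= T b.
    case: m m_gt0 m_le J Z d J_neq0 ZC dJ => // k _ k_lt J Z d J_neq0 ZC dJ.
    have le_sum (I : finType) (P : pred I) (F : I -> R) i :
        P i -> (forall j, 0 <= F j) -> F i <= \sum_(j | P j) F j.
      by move=> Pi F_ge0; rewrite (bigD1 i)//= lerDl sumr_ge0.
    pose tJ (k' : 'I_n) Z' :=
      \sum_(J' : {set 'I_(L * Mdim k'.+1)} | J' != finset.set0) t k'.+1 Z' J' b.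
    pose tZ (k' : 'I_n) := \sum_(Z' in clustering_sequences k'.+1 n n0 L) tJ k' Z'.
    have tJ_ge0 k' Z' : 0 <= tJ k' Z' by rewrite sumr_ge0.
    have tZ_ge0 k' : 0 <= tZ k' by rewrite sumr_ge0.
    apply: (@le_trans _ _ (tJ (Ordinal k_lt) Z)).
      exact: (le_sum _ _ (fun J' : {set 'I_(L * Mdim k.+1)} => t k.+1 Z J' b)).
    apply: (@le_trans _ _ (tZ (Ordinal k_lt))); first exact: (le_sum _ _ (tJ (Ordinal k_lt))).
    apply: (@le_trans _ _ (\sum_k' tZ k')); first exact: (le_sum _ _ tZ).
    by rewrite /T lerDr.
  have : ln (t m Z J b) <= ln (T b) by rewrite ler_ln ?posrE ?expR_gt0// (lt_le_trans _ (T_ge1 b)).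
  rewrite /t expRK /penalty_of => lnt_le.
  have lnC_ge0 := ln_card_ge0 m_gt0.
  (* [6 * h] is [ln 8]. As [#|J| >= 1], this gives [#|J|.+1 * h <= #|J| * ell / 3], so that all
     subtracted terms of [t] fit into [penalty_of / 3], that is into 11/3 of [lnC] and 11/6 of
     [#|J| * ell]. *)
  have h_le : 6 * h <= ell m #|J|.
    apply: le_trans (ell_ge J_neq0).
    rewrite mulr_natl /h -lnXn// ler_ln ?posrE ?exprn_gt0//.
    by rewrite (exprM _ 2 3) sqr_sqrtr//; lra.
  have h_ge0 : 0 <= h by rewrite ln_ge0// -[leLHS]sqrtr1 ler_sqrt// ler1n.
  have j_ge1 : 1 <= #|J|%:R :> R by rewrite ler1n card_gt0.
  move: lnt_le; rewrite -natr1; nra.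
Qed.

End envelope.

(** Deterministic for each outcome [b]: all randomness sits in [T], chosen before the estimator [q]
    and the oracle [p]. The squared error is doubled because the squared tensor norm is twice that
    of the vectorized tensor. *)
Lemma oracle_inequality (R : realType) (n L n0 : nat) (H : 'M[R]_L)
    (theta : 'cV[R]_(L * Ndim n)) :
  (forall s, 0 <= theta s ord0 <= 1) -> (0 < n)%N -> (0 < L)%N -> (n0 <= n)%N ->
  exists T : {ffun 'I_(L * Ndim n) -> bool} -> R,
  [/\ forall b, 1 <= T b,
      \sum_b bernoulli_weight theta b * T b <= 3 &
      forall (b : {ffun _ -> bool}) (q p : params R n L),
        penalized_lse n0 H (\col_s (b s)%:R) q -> admissible n0 p ->
        2 * vnorm (fit H (clust q) (coef q) - theta) ^+ 2 <=
        6 * vnorm (fit H (clust p) (restrict_to (supp p) (coef p)) - theta) ^+ 2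
        + 4 * Pen R n n0 L #|supp p| (nclass p) + 12 * ln (T b)].
Proof.
move=> theta01 n_gt0 L_gt0 n0n.
have [T [T_ge1 T_mean T_bound]] := exists_envelope n0 H theta01 n_gt0 L_gt0.
exists T; split=> // b q p [[[q_m q_J q_C] q_coef] q_min] [p_m p_J p_C].
have p_coef j : j \notin supp p -> restrict_to (supp p) (coef p) j ord0 = 0.
  by move=> /negPf jp; rewrite mxE jp.
(* An admissible [p] may have coefficients off its support; restricting them makes it a feasible
   competitor. *)
have := q_min (Params (supp p) (restrict_to (supp p) (coef p)) (clust p)).
rewrite /criterion /= => /(_ (conj (And3 p_m p_J p_C) p_coef)).
have noiseq := T_bound b _ _ _ _ (3^-1) q_m q_J q_C q_coef.
have noisep := T_bound b _ _ _ _ (-1) p_m p_J p_C p_coef.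
have [m_gt0 _] := andP p_m.
have := @penalty_of_le_Pen R n n0 L (nclass p) #|supp p| m_gt0 n_gt0 L_gt0 n0n.
move: noiseq noisep; rewrite /penalty_of /= !vnorm_sqr.
set zq := fit H (clust q) _ - theta.
set zp := fit H (clust p) _ - theta.
set xi := noise theta b.
have sqr_split (z : 'cV[R]_(L * Ndim n)) : \sum_i (xi - z) i ord0 ^+ 2 =
    \sum_i xi i ord0 ^+ 2 - 2 * (\sum_i xi i ord0 * z i ord0) + \sum_i z i ord0 ^+ 2.
  rewrite mulr_sumr -sumrB -big_split /=; apply: eq_bigr => i _.
  by rewrite [(xi - z) i _]mxE [(- z) i _]mxE; ring.
have -> : \col_s (b s)%:R - fit H (clust q) (coef q) = xi - zq.
  by rewrite /xi /zq /noise opprB addrA subrK.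
have -> : \col_s (b s)%:R - fit H (clust p) (restrict_to (supp p) (coef p)) = xi - zp.
  by rewrite /xi /zp /noise opprB addrA subrK.
rewrite !sqr_split.
(* The rest is linear in the abstracted terms. Minimality plus three times the bound for [zq] plus
   the bound for [zp] cancels the estimator's penalty exactly and leaves 2/3 of the error at most 2
   bias + 4/3 penalty + 4 [ln (T b)]; multiplying by 3 gives the claim. *)
move: (\sum_i xi i ord0 ^+ 2) (\sum_i xi i ord0 * zq i ord0) (\sum_i zq i ord0 ^+ 2).
move: (\sum_i xi i ord0 * zp i ord0) (\sum_i zp i ord0 ^+ 2) => a1 a2 a3 a4 a5.
move: (11 * _) (11 / 2 * _ * _) (ln (T b)) (Pen _ _ _ _ _ _) => b1 b2 b3 b4.
move: (11 * _) (11 / 2 * _ * _) => c1 c2.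
lra.
Qed.

(** * From tensors to vectors, and from integrals to finite sums *)

Lemma sum_node_pairs (V : nmodType) n L (F : 'I_n -> 'I_n -> 'I_L -> V) :
  \sum_(s < L * Ndim n) (let: (l, r) := mxtens_unindex s in
      F (enum_val r).1 (enum_val r).2 l) =
  \sum_(i < n) \sum_(j < n | (i < j)%N) \sum_l F i j l.
Proof.
pose G (x : 'I_L * 'I_(Ndim n)) := F (enum_val x.2).1 (enum_val x.2).2 x.1.
transitivity (\sum_(s < L * Ndim n) G (mxtens_unindex s)).
  exact: eq_bigr.
rewrite (reindex (@mxtens_index L (Ndim n))); last first.
  by exists (@mxtens_unindex L (Ndim n)) => s _; [exact: mxtens_indexK | exact: mxtens_unindexK].
transitivity (\sum_x G x); first by apply: eq_bigr => x _; congr G; exact: mxtens_indexK.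
rewrite -(pair_big xpredT xpredT (fun l r =>
  F (@enum_val _ (mem (node_pairs n)) r).1 (@enum_val _ (mem (node_pairs n)) r).2 l)) /=.
rewrite exchange_big /=.
rewrite -(big_enum_val (A := mem (node_pairs n)) (fun x => \sum_l F x.1 x.2 l)) /=.
under eq_bigl do rewrite inE.
by rewrite -(pair_big_dep xpredT (fun i j : 'I_n => (i < j)%N) (fun i j => \sum_l F i j l)).
Qed.

(** By symmetry the entries below the diagonal repeat those above it, and the diagonal vanishes. *)
Lemma tnorm_sqr (R : realType) n L (T : tensor R n L) : symmetric_hollow T ->
  tnorm T ^+ 2 = 2 * vnorm (vectorize T) ^+ 2.
Proof.
move=> [T_sym T_hollow]; rewrite vnorm_sqr sqr_sqrtr; last first.
  by do 3![rewrite sumr_ge0// => ? _]; exact: sqr_ge0.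
have -> : \sum_s vectorize T s ord0 ^+ 2 =
    \sum_(i < n) \sum_(j < n | (i < j)%N) \sum_l T i j l ^+ 2.
  rewrite -(sum_node_pairs (fun i j l => T i j l ^+ 2)).
  by apply: eq_bigr => s _; rewrite mxE.
have lower : \sum_(i < n) \sum_(j < n | (j < i)%N) \sum_l T i j l ^+ 2 =
    \sum_(i < n) \sum_(j < n | (i < j)%N) \sum_l T i j l ^+ 2.
  rewrite (exchange_big_dep xpredT) //=; apply: eq_bigr => i _; apply: eq_bigr => j _.
  by apply: eq_bigr => l _; rewrite T_sym.
rewrite mulr_natl mulr2n -{1}lower -big_split /=; apply: eq_bigr => i _.
rewrite (bigID (fun j : 'I_n => (j < i)%N)) /=; congr (_ + _).
under eq_bigl do rewrite -leqNgt.
rewrite (bigD1 i) //= big1 => [|l _]; last by rewrite T_hollow expr0n.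
by rewrite add0r; apply: eq_bigl => j; rewrite ltn_neqAle andbC eq_sym.
Qed.

(** A function of a finitely valued variable is a combination of indicators of its fibres;
    measurability is asked of the fibres only, so [I] carries no sigma-algebra. *)
Lemma integral_finite_law (d : measure_display) (T : measurableType d) (R : realType)
    (P : probability T R) (I : finType) (X : T -> I) (w f : I -> R) :
  (forall i, measurable (X @^-1` [set i])) -> (forall i, P (X @^-1` [set i]) = (w i)%:E) ->
  (forall i, 0 <= f i) ->
  measurable_fun setT (fun x => f (X x)) /\
  (\int[P]_x (f (X x))%:E = (\sum_i w i * f i)%:E)%E.
Proof.
move=> mX PX f_ge0.
have fXE x : f (X x) = \sum_i f i * \1_(X @^-1` [set i]) x.
  rewrite (bigD1 (X x)) //= indicE mem_set// mulr1 big1 ?addr0// => i i_neq.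
  by rewrite indicE memNset ?mulr0// => /= Xi; rewrite Xi eqxx in i_neq.
have m1 i : measurable_fun setT (fun x => f i * \1_(X @^-1` [set i]) x).
  by apply: measurable_funM => //; exact: measurable_indic.
split.
  by rewrite (funext fXE); exact: measurable_sum.
under eq_integral do rewrite fXE -sumEFin.
rewrite ge0_integral_sum//; last 2 first.
- by move=> i; apply/measurable_EFinP; exact: m1.
- by move=> i x _; rewrite lee_fin mulr_ge0.
rewrite -sumEFin; apply: eq_bigr => i _.
under eq_integral do rewrite EFinM.
rewrite ge0_integralZl_EFin//; last by apply/measurable_EFinP; exact: measurable_indic.
rewrite integral_indic// setIT.
by apply: etrans (congr1 (mule _) (PX i)) _; rewrite -EFinM mulrC.
Qed.

(** * Law of the observations *)

Lemma independent_bool_law d (T : measurableType d) (R : realType) (P : probability T R)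
    (I : finType) (D : {set I}) (B : I -> {RV P >-> bool}) N (node : 'I_N -> I)
    (theta : 'cV[R]_N) (c : {ffun 'I_N -> bool}) :
  mutually_independent P D (fun x => B x : T -> bool) ->
  injective node -> (forall s, node s \in D) ->
  (forall s, P [set w | B (node s) w = true] = (theta s ord0)%:E) ->
  let X w := [ffun s => B (node s) w] in
  measurable (X @^-1` [set c]) /\ P (X @^-1` [set c]) = (bernoulli_weight theta c)%:E.
Proof.
move=> B_indep node_inj node_D B_law X.
pose F : {set I} := [set node s | s in 'I_N]%SET.
(* Defined on all of [I], as independence demands: at [node s] injectivity reduces it to the
   singleton of [c s], and off the image of [node] the condition is vacuous. *)
pose A x : set bool := [set v | forall s, node s = x -> v = c s].
have A_node s : A (node s) = [set c s].
  by apply/seteqP; split=> v /= => [/(_ s erefl)//|-> s' /node_inj ->].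
have X_fiber : X @^-1` [set c] = \bigcap_(x in [set` F]) (B x @^-1` A x).
  apply/seteqP; split=> w /=.
    by move=> Xc x /= _ s <-; rewrite -Xc ffunE.
  move=> Fw; apply/ffunP => s; rewrite ffunE.
  by apply: (Fw (node s)) => //=; apply/imsetP; exists s.
have mB x Y : measurable (B x @^-1` Y) by exact: measurable_funPTI.
split; first by rewrite X_fiber; apply: fin_bigcap_measurable.
rewrite X_fiber B_indep//; last by apply/fintype.subsetP => _ /imsetP[s _ ->].
rewrite big_imset /=; last by move=> s s' _ _; exact: node_inj.
rewrite -prodEFin; apply: eq_big => // s _; rewrite A_node.
have B_true : B (node s) @^-1` [set true] = [set w | B (node s) w = true] by [].
case: (c s); first by rewrite B_true B_law.
have -> : B (node s) @^-1` [set false] = ~` (B (node s) @^-1` [set true]).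
  by apply/seteqP; split=> w /=; case: (B (node s) w).
by rewrite probability_setC// B_true B_law EFinB.
Qed.

Lemma penalty_of_ge0 (R : realType) n n0 L m (J : {set 'I_(L * Mdim m)}) :
  (0 < m)%N -> (0 < n)%N -> (0 < L)%N -> J != finset.set0 ->
  0 <= penalty_of R n n0 L m #|J|.
Proof.
move=> m_gt0 n_gt0 L_gt0 J_neq0.
have ell0 : 0 <= ln (25 * m%:R ^+ 2 * L%:R / #|J|%:R) :> R.
  by apply: le_trans (ell_ge R J_neq0); rewrite ln_ge0//; lra.
by rewrite /penalty_of addr_ge0// mulr_ge0// ln_card_ge0.
Qed.

Theorem corollary1 (R : realType) (n L n0 : nat) (le_n0_n : (n0 <= n)%N)
    (H : 'M[R]_L) (orthoH : H *m H^T = 1%:M)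
    (dsp : measure_display) (Omega : measurableType dsp)
    (P : probability Omega R)
    (Lstar : tensor R n L) (Lstar_sh : symmetric_hollow Lstar)
    (B : 'I_n -> 'I_n -> 'I_L -> {RV P >-> bool})
    (B_sym : forall i j l w, B i j l w = B j i l w)
    (B_diag : forall i l w, B i i l w = false)
    (B_bernoulli : forall (i j : 'I_n) l, (i < j)%N ->
       P [set w | B i j l w = true] = (Lstar i j l)%:E)
    (B_indep : mutually_independent P
       [set x : 'I_n * 'I_n * 'I_L | (x.1.1 < x.1.2)%N]%SET
       (fun x => B x.1.1 x.1.2 x.2))
    (est : Omega -> params R n L)
    (est_min : forall w,
       penalized_lse n0 H (vectorize (fun i j l => (B i j l w)%:R)) (est w))
    (Lhat : Omega -> tensor R n L)
    (Lhat_sh : forall w, symmetric_hollow (Lhat w))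
    (Lhat_vec : forall w,
       vectorize (Lhat w) = fit H (clust (est w)) (coef (est w)))
    (Lhat_meas : forall i j l, measurable_fun setT (fun w => Lhat w i j l)) :
  let loss := fun w =>
    tnorm (fun i j l => Lhat w i j l - Lstar i j l) ^+ 2 / (n%:R ^+ 2 * L%:R) in
  let bias := fun p : params R n L =>
    6 * vnorm (fit H (clust p) (restrict_to (supp p) (coef p))
               - vectorize Lstar) ^+ 2 / (n%:R ^+ 2 * L%:R) in
  let penalty := fun p : params R n L =>
    4 * Pen R n n0 L #|supp p| (nclass p) / (n%:R ^+ 2 * L%:R) in
  (forall t : R, 0 < t ->
     ((1 - 9 * expR (- t))%:E <=
      P [set w | (loss w <=
                  inf [set bias p + penalty p | p in @admissible R n n0 L]
                  + 38 * t / (n%:R ^+ 2 * L%:R))%R])%E) /\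
  ('E_P[loss] <=
     (inf [set bias p + penalty p + 342 / (n%:R ^+ 2 * L%:R)
          | p in @admissible R n n0 L])%:E)%E.
Proof.
move=> loss bias penalty.
pose theta := vectorize Lstar.
(* Stacked coordinates correspond injectively to triples with [i < j], where the observations are
   independent; [X] gathers these into one variable with finitely many values. *)
pose node (s : 'I_(L * Ndim n)) : 'I_n * 'I_n * 'I_L := let: (l, r) := mxtens_unindex s in
  (@enum_val _ (node_pairs n) r, l).
pose X w : {ffun 'I_(L * Ndim n) -> bool} := [ffun s => B (node s).1.1 (node s).1.2 (node s).2 w].
have node_inj : injective node.
  move=> s s'; rewrite /node -{2}(mxtens_unindexK s) -{2}(mxtens_unindexK s').
  case: (mxtens_unindex s) (mxtens_unindex s') => l r [l' r'] [rr ->].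
  by rewrite (enum_val_inj rr).
have node_D s : node s \in [set x : 'I_n * 'I_n * 'I_L | (x.1.1 < x.1.2)%N]%SET.
  by rewrite inE; have := @enum_valP _ (mem (node_pairs n)) (mxtens_unindex s).2; rewrite inE.
have node_law s : P [set w | B (node s).1.1 (node s).1.2 (node s).2 w = true] =
    (theta s ord0)%:E.
  by rewrite B_bernoulli ?mxE//; have := node_D s; rewrite inE.
have X_law c := @independent_bool_law _ Omega R P _ _
  (fun x => B x.1.1 x.1.2 x.2) _ node theta c B_indep node_inj node_D node_law.
have theta01 s : 0 <= theta s ord0 <= 1.
  rewrite -!lee_fin -node_law measure_ge0/=.
  by apply: probability_le1; exact: (measurable_funPTI (B _ _ _) (Y := [set true])).
have a_eq w : vectorize (fun i j l => (B i j l w)%:R) = \col_s (X w s)%:R :> 'cV[R]_(L * Ndim n).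
  by apply/colP => s; rewrite !mxE ffunE.
(* A space of mass 1 has a point. The estimate there is admissible, which forces [n] and [L] to be
   positive and makes the sets under the infima nonempty. *)
have [w0 _] : exists w : Omega, True.
  apply: contrapT => no_w; have := @probability_setT _ Omega R P.
  rewrite (_ : setT = set0) ?measure0; first by move=> /eqP; rewrite eq_sym onee_eq0.
  by apply/seteqP; split=> w // _; apply: no_w; exists w.
have [[est0 _] _] := est_min w0.
have [/andP[m_gt0 m_le] J_neq0 _] := est0.
have n_gt0 : (0 < n)%N by exact: leq_trans m_gt0 m_le.
have L_gt0 : (0 < L)%N.
  case/set0Pn: J_neq0 => s _; have : (0 < L * Mdim (nclass (est w0)))%N.
    exact: leq_ltn_trans (leq0n _) (ltn_ord s).
  by rewrite muln_gt0 => /andP[].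
have [T [T_ge1 T_mean T_bound]] := @oracle_inequality R n L n0 H theta theta01 n_gt0 L_gt0 le_n0_n.
pose V : R := n%:R ^+ 2 * L%:R.
have V_gt0 : 0 < V by rewrite mulr_gt0 ?exprn_gt0 ?ltr0n.
have lossE w : loss w = 2 * vnorm (fit H (clust (est w)) (coef (est w)) - theta) ^+ 2 / V.
  rewrite /loss tnorm_sqr; last first.
    have [Lhat_sym Lhat_0] := Lhat_sh w; have [Lstar_sym Lstar_0] := Lstar_sh.
    by split=> *; rewrite ?Lhat_0 ?Lstar_0 ?subr0// Lhat_sym Lstar_sym.
  rewrite -Lhat_vec; congr (2 * vnorm _ ^+ 2 / _).
  by apply/colP => s; rewrite !mxE.
have loss_le w p : admissible n0 p -> loss w <= bias p + penalty p + 12 * ln (T (X w)) / V.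
  move=> p_adm; have := est_min w; rewrite a_eq => /T_bound /(_ p_adm).
  by rewrite lossE /bias /penalty -/V -!mulrDl ler_pM2r ?invr_gt0.
have loss_ge0 w : 0 <= loss w by rewrite lossE divr_ge0 ?(ltW V_gt0)// mulr_ge0// sqr_ge0.
have loss_meas : measurable_fun setT loss.
  have -> : loss = fun w => (\sum_i \sum_j \sum_l (Lhat w i j l - Lstar i j l) ^+ 2) / V.
    apply/funext => w; rewrite /loss /tnorm sqr_sqrtr//.
    by do 3![rewrite sumr_ge0// => ? _]; exact: sqr_ge0.
  apply: measurable_funM => //; do 3![apply: measurable_sum => ?].
  by apply: measurable_funX; apply: measurable_funB.
have law f := integral_finite_law (fun c => (X_law c).1) (fun c => (X_law c).2) (f := f).
split=> [t t_gt0|].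
  set S := [set w | _].
  have S_meas : measurable S.
    rewrite -[S]setTI; exact: (measurable_fun_le measurableT loss_meas (measurable_cst _)).
  have T_ge0 c : 0 <= expR (- t) * T c.
    by rewrite mulr_ge0 ?expR_ge0// (le_trans ler01).
  have [gX_meas gX_int] := law (fun c => expR (- t) * T c) T_ge0.
  (* Markov's inequality: if [ln (T (X w)) < t], the remainder is below [12 * t / V], hence below
     [38 * t / V], so outside [S] the variable [expR (- t) * T (X w)] is at least 1, while its mean
     is at most [3 * expR (- t)]. The factor 9 in the claim leaves slack. *)
  have PSC_le : (P (~` S) <= (3 * expR (- t))%:E)%E.
    rewrite -[~` S]setIT -integral_indic//; last exact: measurableC.
    apply: (@le_trans _ _ (\int[P]_w (expR (- t) * T (X w))%:E)%E).
      apply: ge0_le_integral => //.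
      - by apply/measurable_EFinP; exact/measurable_indic/measurableC.
      - exact/measurable_EFinP.
      move=> w _; rewrite lee_fin indicE; case: (boolP (w \in _)) => [|_]; last exact: T_ge0.
      rewrite inE /= => wS.
      rewrite expRN ler_pdivlMl ?expR_gt0// mulr1.
      have lnT_ge0 : 0 <= ln (T (X w)) by rewrite ln_ge0.
      have T_gt0 : 0 < T (X w) by exact: lt_le_trans (T_ge1 _).
      rewrite -[leRHS]lnK ?posrE// ler_expR leNgt; apply/negP => lnT_lt; apply: wS.
      (* The remainder is the same for every admissible [p], so the bound passes to the infimum. *)
      rewrite /S /= -lerBlDr; apply: lb_le_inf.
        by exists (bias (est w0) + penalty (est w0)); exists (est w0).
      move=> _ [p p_adm <-]; rewrite lerBlDr (le_trans (loss_le w p p_adm))//.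
      by rewrite lerD2l -/V ler_pM2r ?invr_gt0//; lra.
    rewrite gX_int lee_fin; under eq_bigr do rewrite mulrCA.
    by rewrite -mulr_sumr mulrC ler_wpM2r ?expR_ge0.
  move: PSC_le; rewrite probability_setC//.
  rewrite -(@fineK _ (P S)) ?fin_num_measure// -EFinB !lee_fin.
  by have := expR_ge0 (- t); lra.
have adm_ne : [set bias p + penalty p + 342 / V | p in @admissible R n n0 L] !=set0.
  by exists (bias (est w0) + penalty (est w0) + 342 / V); exists (est w0).
rewrite unlock.
(* Integrates [loss_le] after [ln T <= T]; the mean of [T] is at most 3, so the remainder is at most
   [36 / V], within [342 / V]. *)
have loss_int p : admissible n0 p ->
    (\int[P]_w (loss w)%:E <= (bias p + penalty p + 342 / V)%:E)%E.
  move=> p_adm; pose k := bias p + penalty p.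
  have k_ge0 : 0 <= k.
    have [/andP[p_gt0 _] p_J _] := p_adm.
    have Pen_ge0 : 0 <= Pen R n n0 L #|supp p| (nclass p).
      apply: le_trans (penalty_of_le_Pen R #|supp p| p_gt0 n_gt0 L_gt0 le_n0_n).
      exact: penalty_of_ge0.
    by rewrite addr_ge0// divr_ge0 ?(ltW V_gt0)// mulr_ge0// sqr_ge0.
  have g_ge0 c : 0 <= k + 12 * T c / V.
    by rewrite addr_ge0// divr_ge0 ?(ltW V_gt0)// mulr_ge0// (le_trans ler01).
  have [gX_meas gX_int] := law (fun c => k + 12 * T c / V) g_ge0.
  apply: (@le_trans _ _ (\int[P]_w (k + 12 * T (X w) / V)%:E)%E).
    apply: ge0_le_integral => //.
    - by move=> w _; rewrite lee_fin.
    - exact/measurable_EFinP.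
    - exact/measurable_EFinP.
    move=> w _; rewrite lee_fin (le_trans (loss_le w p p_adm))// lerD2l.
    rewrite ler_pM2r ?invr_gt0// ler_pM2l//.
    have T_gt0 : 0 < T (X w) by exact: lt_le_trans (T_ge1 _).
    by rewrite -ler_expR lnK ?posrE// (le_trans _ (expR_ge1Dx _))// lerDr.
  rewrite gX_int lee_fin; under eq_bigr do rewrite mulrDr.
  rewrite big_split /= -mulr_suml sum_bernoulli_weight mul1r lerD2l.
  under eq_bigr do rewrite mulrA mulrCA.
  rewrite -mulr_suml -mulr_sumr ler_pM2r ?invr_gt0//; lra.
(* The infimum is taken among reals, so the expectation is first shown finite, through the bound for
   the admissible [est w0]. *)
have loss_fin : (\int[P]_w (loss w)%:E)%E \is a fin_num.
  rewrite ge0_fin_numE; last by apply: integral_ge0 => w _; rewrite lee_fin.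
  exact: le_lt_trans (loss_int _ est0) (ltry _).
rewrite -(fineK loss_fin) lee_fin; apply: lb_le_inf => // _ [p p_adm <-].
by rewrite -lee_fin fineK// loss_int.
Qed.
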